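(* For every $\epsilon>0$ there is a constant $C_\epsilon>0$ depending only on $\epsilon$, and for every $\epsilon>0$ and real $\rho\ge 0$ there are constants $c>0$ and $R\ge1$ depending only on $\rho$ and $\epsilon$, such that the following holds. Let $G$ be a connected graph with exact growth rate $\mathrm{er}(G)=\rho<\infty$. Then there exist $n\in\mathbb{N}$ with $n\le C_\epsilon\max\{\rho\log\rho,\,1\}$ and an injective map $f\colon V(G)\to\mathbb{Z}^n$ such that for all $u,v\in V(G)$, $$\|f(u)-f(v)\|_\infty\le\mathrm{dist}_G(u,v),$$ and $$\|f(u)-f(v)\|_\infty\ge c\,\mathrm{dist}_G(u,v)^{1-\epsilon}\quad\text{whenever }\mathrm{dist}_G(u,v)\ge R.$$
   Context: Graphs are undirected and simple, possibly infinite. $\mathrm{dist}_G$ is the graph metric and $B_G(u,r)$ is the closed ball of radius $r$ around $u$. The growth function is $\gamma_G(r)=\sup_{u\in V(G)}|B_G(u,r)|$; for $r\ge 1$ put $\rho(G,r)=\log\gamma_G(r)/\log(r+1)$. The exact growth rate is $\mathrm{er}(G)=\sup_{r\ge 1}\rho(G,r)$. We put $\rho\log\rho=0$ for $\rho=0$. The metric $\|x-y\|_\infty$ on $\mathbb{Z}^n$ is the graph metric $\mathrm{dist}_\infty$ of the $n$-dimensional grid with diagonals (vertices $x,y\in\mathbb{Z}^n$ adjacent iff $\|x-y\|_\infty=1$). *)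

(* Defs.v *)
From HB Require Import structures.
From mathcomp Require Import all_boot all_order all_algebra.
From mathcomp Require Import all_classical all_reals all_analysis.

Set Implicit Arguments.
Unset Strict Implicit.
Unset Printing Implicit Defensive.

Import Order.TTheory GRing.Theory Num.Theory.
Import numFieldNormedType.Exports.

Local Open Scope classical_set_scope.
Local Open Scope ring_scope.

(* In the presence of the classical axioms of [boolp], every type carries a
   [choiceType] structure ([gen_choiceMixin]) and every relation is boolean
   ([asbool]), so neither choice restricts the (possibly infinite) graphs. *)
Record sgraph := SGraph {
  vertex :> choiceType;
  adj : rel vertex;
  adj_sym : symmetric adj;
  adj_irrefl : irreflexive adj
}.

Section Distance.
Variable G : sgraph.
Implicit Types (u v : G) (n r : nat).

Definition walk u v n : Prop :=
  exists p : seq G, [/\ path (@adj G) u p, last u p = v & size p = n].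

Definition reachable u v : Prop := exists n, walk u v n.

Definition connected_graph : Prop :=
  inhabited G /\ forall u v, reachable u v.

Lemma reachable_asbool u v : reachable u v -> exists n, `[< walk u v n >].
Proof. by case=> n un; exists n; apply/asboolP. Qed.

(* The least length of a walk; the value 0 for unreachable pairs is a dummy,
   which is why [gball] also requires reachability. *)
Definition dist u v : nat :=
  if pselect (reachable u v) is left h
  then ex_minn (reachable_asbool h) else 0%N.

Definition gball u r : set G := [set v | reachable u v /\ (dist u v <= r)%N].

End Distance.

Section Growth.
Variables (R : realType) (G : sgraph).
Local Open Scope ereal_scope.

(* [counting] is the cardinality, +oo on infinite sets. *)
Definition growth (r : nat) : \bar R :=
  ereal_sup [set counting (gball u r) | u in [set: G]].

Definition growth_exponent (r : nat) : \bar R :=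
  lne (growth r) * ((ln r.+1%:R)^-1)%:E.

Definition exact_growth_rate : \bar R :=
  ereal_sup [set growth_exponent r | r in [set r : nat | (1 <= r)%N]].

End Growth.

(* Main.v *)
Require Import Defs.
From mathcomp Require Import all_boot all_order all_algebra.
From mathcomp Require Import all_classical all_reals all_analysis.
From mathcomp Require Import ring lra zify.
Import Order.TTheory GRing.Theory Num.Theory.
Import numFieldNormedType.Exports.
Local Open Scope ring_scope.

Set Implicit Arguments.
Unset Strict Implicit.
Unset Printing Implicit Defensive.

(** Only the integer-valued metric [d = dist] matters, together with the bound
    |B(u,r)| <= (r+1)^P for r >= 1, where P is an integer slightly above rho.

    One scale.  Fix s and a finite set S of vertices, draw independent
    geometric variables E_z truncated to {0..s} for z in S, and put
    phi(x) = max_z (E_z - d(x,z)).  This function is 1-Lipschitz, has values in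
    {0..s}, and depends only on the E_z with d(x,z) <= s.  A geometric variable
    that has reached a level passes any further h units with probability q^h;
    hence phi(x) falls into a prescribed window of length h with probability at
    most 1 - q^h + |B(x,s)| q^(s-h), the last term being the price of the
    truncation ([pr_max_window]).  With b = 2^e, s = b^m, h = b^(m-2) and
    q = 1 - b^-(m-1) this is O(1/b) as soon as b exceeds a polynomial in P and
    m.  If d(x,y) > 2s then phi(x) and phi(y) are independent, so n independent
    copies all fail to separate x from y by h with probability O(1/b)^n, whereas
    such a pair interacts with b^O(mP) other pairs.  For n of order mP the local
    lemma yields maps that separate all pairs at distance comparable with s,
    up to the power 1 + O(1/m), and this remains true when an arbitrary
    prescribed quantity t(x,y) is subtracted from phi(x) - phi(y)
    ([one_scale]).

    All scales.  Let e_k grow by the factor 1 + 7/m, with scale s_k = 2^(m e_k),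
    and take the integer part of sum_k phi_k / 2^(e_k).  The weights add up to
    at most 1, so the sum is 1-Lipschitz.  The phi_k are chosen from the largest
    scale down: t absorbs the contribution of the larger scales, and the smaller
    scales together contribute a small fraction of h_k / 2^(e_k).  A pair at
    distance D in (2 s_k, 2 s_(k+1)] is thus separated by a constant multiple of
    2^((m-3) e_k), which is at least D^(1 - 12/(m+8)) ([embed_finite]); this
    is at least D^(1-eps) when m >= 12/eps.

    Near pairs.  Pairs at distance at most 2 s_0 are told apart by a greedy
    colouring with (2 s_0 + 1)^P colours, written in binary
    ([proper_colouring]).  Since 2^(e_0) is polynomial in P for fixed m, this
    takes O(P (1 + log P)) further coordinates with values in {0,1}.

    All of this is done on finite sets of vertices.  Balls are finite, and an
    ultrafilter limit along the balls around a vertex gives a map on the whole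
    graph ([lipschitz_limit]). *)

(** * The local lemma *)

Section LocalLemma.
Variables (R : realFieldType) (O : finType) (W : O -> R).
Hypothesis W_ge0 : forall w, 0 <= W w.

(** The measure with density [W] on a finite set. *)
Definition mass (X : {set O}) : R := \sum_(w in X) W w.

Lemma mass_ge0 X : 0 <= mass X.
Proof. exact: sumr_ge0. Qed.

Lemma massS (X Y : {set O}) : X \subset Y -> mass X <= mass Y.
Proof.
move=> XY; rewrite /mass [leRHS](big_setID X) /= (finset.setIidPr XY) lerDl.
exact: sumr_ge0.
Qed.

Lemma massID X Y : mass X = mass (X :&: Y) + mass (X :\: Y).
Proof. exact: big_setID. Qed.

Variables (J : finType) (bad : J -> {set O}).

(** The outcomes at which no event [bad j] with [j] in [T] occurs. *)
Definition avoid (T : {set J}) : {set O} :=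
  [set w | [forall j in T, w \notin bad j]].

Lemma in_avoid T w : (w \in avoid T) = [forall j in T, w \notin bad j].
Proof. by rewrite inE. Qed.

Lemma avoidU1 j T : avoid (j |: T) = avoid T :\: bad j.
Proof.
apply/setP=> w; rewrite !inE; apply/idP/andP => [/forall_inP h|[jw /forall_inP h]].
  split; first by apply: h; rewrite finset.setU11.
  by apply/forall_inP => k kT; apply: h; rewrite finset.setU1r.
by apply/forall_inP => k /setU1P[->//|]; exact: h.
Qed.

Lemma avoidS (T T' : {set J}) : T' \subset T -> avoid T \subset avoid T'.
Proof.
move=> sT; apply/fintype.subsetP => w; rewrite !inE => /forall_inP h.
by apply/forall_inP => k /(fintype.subsetP sT); exact: h.
Qed.

Variables (nb : rel J) (p : R) (d : nat).
Hypothesis p_ge0 : 0 <= p.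
Hypothesis d_gt0 : (0 < d)%N.
Hypothesis pd : 4 * p * d%:R <= 1.
Hypothesis nb_le : forall j, (#|[set k | nb j k]| <= d)%N.
(* [nb j] lists the events that may depend on [bad j].  Instead of independence,
   only the bound on the conditional probability that the proof uses is
   assumed. *)
Hypothesis indep : forall j (T : {set J}), (forall k, k \in T -> ~~ nb j k) ->
  mass (bad j :&: avoid T) <= p * mass (avoid T).

Lemma mass_avoidU1 j T :
  mass (avoid (j |: T)) = mass (avoid T) - mass (bad j :&: avoid T).
Proof.
by rewrite avoidU1 [in RHS](massID (avoid T) (bad j)) finset.setIC; ring.
Qed.

Lemma mass_avoidU (T T' : {set J}) (b : R) :
  (forall f, f \in T -> mass (bad f :&: avoid T') <= b) ->
  mass (avoid T') - #|T|%:R * b <= mass (avoid (T :|: T')).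
Proof.
rewrite cardE -[in X in _ -> _ <= X](set_enum T) => Tb.
have {}Tb f : f \in enum T -> mass (bad f :&: avoid T') <= b.
  by rewrite mem_enum; exact: Tb.
elim: (enum T) Tb => [|x s IH] /= Tb.
  rewrite mul0r subr0 le_eqVlt; apply/orP; left; apply/eqP; congr (mass (avoid _)).
  by apply/setP => y; rewrite !inE.
have -> : [set y in x :: s] :|: T' = x |: ([set y in s] :|: T').
  by apply/setP => y; rewrite !inE orbA.
rewrite mass_avoidU1 -natr1 mulrDl mul1r opprD addrA lerD //.
  by apply: IH => f fs; apply: Tb; rewrite inE fs orbT.
rewrite lerN2 (le_trans _ (Tb x _)) ?mem_head //.
by apply/massS/finset.setIS/avoidS/finset.subsetUr.
Qed.

(** Conditioned on avoiding [T], the event [bad j] has probability at most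
    [2 * p]: avoiding the non-neighbours of [j] first, each of the at most [d]
    neighbours has conditional probability at most [2 * p] by induction, so
    avoiding them as well costs at most the factor 1 - 2pd >= 1/2. *)
Lemma mass_bad_avoid n j (T : {set J}) : (#|T| <= n)%N ->
  mass (bad j :&: avoid T) <= 2 * p * mass (avoid T).
Proof.
elim: n j T => [|n IH] j T Tn.
  have -> : T = finset.set0 by apply/eqP; rewrite -cards_eq0 -leqn0.
  have := @indep j finset.set0 (fun k => ltac:(by rewrite inE)).
  have := mulr_ge0 p_ge0 (mass_ge0 (avoid finset.set0)); lra.
pose T1 := T :&: [set k | nb j k]; pose T2 := T :\: [set k | nb j k].
have T12 : T1 :|: T2 = T by exact: finset.setID.
have T2_indep : mass (bad j :&: avoid T2) <= p * mass (avoid T2).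
  by apply: indep => k; rewrite !inE => /andP[].
have badT : mass (bad j :&: avoid T) <= mass (bad j :&: avoid T2).
  by apply/massS/finset.setIS/avoidS/finset.subsetDl.
have [T10|T1n0] := eqVneq T1 finset.set0.
  rewrite -T12 T10 finset.set0U; have := mulr_ge0 p_ge0 (mass_ge0 (avoid T2)); lra.
have T2n : (#|T2| <= n)%N.
  have := cardsID [set k | nb j k] T; rewrite -/T1 -/T2.
  have : (0 < #|T1|)%N by rewrite card_gt0.
  lia.
have := @mass_avoidU T1 T2 _ (fun f _ => IH f T2 T2n).
have T1d : (#|T1|%:R : R) <= d%:R.
  by rewrite ler_nat (leq_trans _ (nb_le j)) ?subset_leq_card ?finset.subsetIr.
rewrite T12; have := mass_ge0 (avoid T2).
set a := mass (avoid T2) in T2_indep * => a0 T2T.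
have : #|T1|%:R * (2 * p * a) <= d%:R * (2 * p * a) by rewrite ler_wpM2r ?mulr_ge0.
have : 4 * p * d%:R * a <= 1 * a by rewrite ler_wpM2r.
set t := mass (avoid T) in T2T *; set dR := d%:R : R.
set t1 := #|T1|%:R * _ in T2T *.
move=> h1 h2; have h3 : a <= 2 * t by lra.
apply: le_trans badT _; apply: le_trans T2_indep _.
by rewrite [2 * p]mulrC -mulrA ler_wpM2l.
Qed.

(** The symmetric Lovasz local lemma, in its lopsided form. *)
Lemma local_lemma : 0 < mass finset.setT -> 0 < mass (avoid finset.setT).
Proof.
move=> mT; have p2 : 2 * p < 1.
  have : (1 : R) <= d%:R by rewrite ler1n.
  move: p_ge0 pd; set dR := d%:R : R; nra.
rewrite -(set_enum [set: J]); elim: (enum _) => [|x s IH].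
  rewrite (_ : avoid _ = finset.setT) //; apply/setP => w; rewrite !inE.
  by apply/forall_inP => k; rewrite inE.
have -> : [set y in x :: s] = x |: [set y in s].
  by apply/setP => y; rewrite !inE.
rewrite mass_avoidU1; have := @mass_bad_avoid _ x [set y in s] (leqnn _).
move: IH; set a := mass (avoid _) => a0; nra.
Qed.

End LocalLemma.

(** * Finite product measures *)

Section ProductMass.
Variables (R : realFieldType) (I A : finType) (mu : A -> R).
Hypothesis mu_ge0 : forall a, 0 <= mu a.
Hypothesis mu1 : \sum_a mu a = 1.

Let O := {ffun I -> A}.

(** The density of the product of copies of [mu] indexed by [I]. *)
Definition prodw (w : {ffun I -> A}) : R := \prod_i mu (w i).

Lemma prodw_ge0 w : 0 <= prodw w.
Proof. by apply: prodr_ge0. Qed.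

Lemma mass_prodwT : mass prodw finset.setT = 1.
Proof.
transitivity (\sum_(w : O) prodw w); first by apply: eq_bigl => w; rewrite inE.
rewrite /prodw -(bigA_distr_bigA (fun _ => mu)) /=.
by rewrite big1.
Qed.

(** The outcome [w] with its coordinate [v] replaced by [a]. *)
Definition upd (w : O) (v : I) (a : A) : O :=
  [ffun i => if i == v then a else w i].

(** The event [X] does not depend on the coordinate [v]. *)
Definition free_of (v : I) (X : {set O}) :=
  forall w a, (upd w v a \in X) = (w \in X).

Lemma free_ofI v (X Y : {set O}) : free_of v X -> free_of v Y -> free_of v (X :&: Y).
Proof. by move=> hX hY w a; rewrite !inE hX hY. Qed.

Lemma free_of_coord v v' (B : pred A) : v != v' ->
  free_of v [set w : O | B (w v')].
Proof. by move=> vv w a; rewrite !inE ffunE eq_sym (negPf vv). Qed.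

Lemma prodw_upd w v a : prodw w * mu a = prodw (upd w v a) * mu (w v).
Proof.
rewrite /prodw (bigD1 v) //= [in RHS](bigD1 v) //= ffunE eqxx.
rewrite [in RHS](eq_bigr (fun i => mu (w i))); first by ring.
by move=> i iv; rewrite ffunE (negPf iv).
Qed.

(** Redrawing one coordinate does not change expectations. *)
Lemma resample v (g : O -> R) :
  \sum_(w : O) \sum_a prodw w * mu a * g (upd w v a) = \sum_w prodw w * g w.
Proof.
transitivity (\sum_(w : O) \sum_a prodw w * mu a * g w); last first.
  apply: eq_bigr => w _; rewrite -mulr_suml -mulr_sumr mu1 mulr1 //.
rewrite !pair_big /=.
(* Exchanging the old and the new value preserves the weight, by [prodw_upd]. *)
pose sw (z : O * A) := (upd z.1 v z.2, z.1 v).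
have swK : involutive sw.
  case=> w a; rewrite /sw /= ffunE eqxx; congr pair.
  by apply/ffunP => i; rewrite !ffunE; case: eqP => [->|].
rewrite [RHS](reindex_inj (inv_inj swK)) /=; apply: eq_bigr => -[w a] _ /=.
by rewrite (prodw_upd w v).
Qed.

(** An event that does not depend on [v] is independent of the coordinate [v]. *)
Lemma mass_indep v (X : {set O}) (B : pred A) : free_of v X ->
  mass prodw (X :&: [set w : O | B (w v)]) = mass prodw X * \sum_(a | B a) mu a.
Proof.
move=> hX; have massE (Y : {set O}) : mass prodw Y = \sum_w prodw w * (w \in Y)%:R.
  rewrite /mass [LHS]big_mkcond /=; apply: eq_bigr => w _.
  by case: (w \in Y); rewrite ?mulr1 ?mulr0.
rewrite massE -(resample v) massE mulr_suml; apply: eq_bigr => w _.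
rewrite mulr_sumr [RHS]big_mkcond; apply: eq_bigr => a _ /=.
rewrite finset.in_setI hX inE ffunE eqxx.
by case: (w \in X); case: (B a); rewrite /= ?mulr1 ?mulr0 ?mul0r.
Qed.

End ProductMass.

(** * Truncated geometric variables and maxima *)

Section Geometric.
Variables (R : realFieldType) (q : R) (s : nat).
Hypothesis q01 : 0 <= q <= 1.

(** The law of min(E,s), where P(E >= k) = q^k. *)
Definition tgeom (a : 'I_s.+1) : R := if (a < s)%N then q ^+ a * (1 - q) else q ^+ s.

Let q0 : 0 <= q. Proof. by case/andP: q01. Qed.
Let q1 : q <= 1. Proof. by case/andP: q01. Qed.

Lemma tgeom_ge0 a : 0 <= tgeom a.
Proof. by rewrite /tgeom; case: ifP => _; rewrite ?mulr_ge0 ?exprn_ge0 ?subr_ge0. Qed.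

Lemma tgeom_tail k : (k <= s)%N -> \sum_(a : 'I_s.+1 | (k <= a)%N) tgeom a = q ^+ k.
Proof.
rewrite leq_eqVlt => /predU1P[->|]; last move=> /ltnW.
  rewrite (big_pred1 ord_max) ?/tgeom /= ?ltnn // => a /=.
  by rewrite -val_eqE /=; have := ltn_ord a; lia.
move/subnKC; move: (s - k)%N => j; elim: j k => [|j IH] k kj.
  rewrite addn0 in kj; subst k.
  rewrite (big_pred1 ord_max) ?/tgeom /= ?ltnn // => a /=.
  by rewrite -val_eqE /=; have := ltn_ord a; lia.
have ks : (k < s)%N by lia.
have ks1 : (k < s.+1)%N by lia.
rewrite (bigD1 (Ordinal ks1)) //= /tgeom /= ks.
rewrite (eq_bigl (fun a : 'I_s.+1 => (k.+1 <= a)%N)); last first.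
  by move=> a /=; rewrite -val_eqE /=; lia.
have := IH k.+1; rewrite /tgeom => ->; last by lia.
by rewrite exprS; ring.
Qed.

Lemma tgeom_sum1 : \sum_a tgeom a = 1.
Proof. by rewrite -[RHS](expr0 q) -tgeom_tail. Qed.

(** Loss of memory; the additive error is due to the truncation at [s]. *)
Lemma tgeom_window k h : (h <= s)%N ->
  \sum_(a : 'I_s.+1 | (k <= a < k + h)%N) tgeom a
    <= (1 - q ^+ h) * \sum_(a : 'I_s.+1 | (k <= a)%N) tgeom a + q ^+ (s - h).
Proof.
move=> hs; have [ks|ks] := leqP (k + h) s.
  rewrite tgeom_tail; last by lia.
  have -> : \sum_(a : 'I_s.+1 | (k <= a < k + h)%N) tgeom a = q ^+ k - q ^+ (k + h).
    rewrite -!tgeom_tail; [|by lia..].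
    rewrite [X in X - _](bigID (fun a : 'I_s.+1 => (a < k + h)%N)) /=.
    rewrite [X in _ = _ + X - _](eq_bigl (fun a : 'I_s.+1 => (k + h <= a)%N)) ?addrK //.
    by move=> a /=; lia.
  by rewrite exprD; have := exprn_ge0 (s - h) q0; lra.
apply: le_trans (_ : _ <= q ^+ (s - h)) _; last first.
  rewrite lerDr mulr_ge0 ?subr_ge0 ?exprn_ile1 //.
  by apply: sumr_ge0 => a _; exact: tgeom_ge0.
rewrite -tgeom_tail; last by lia.
rewrite big_mkcond [leRHS]big_mkcond; apply: ler_sum => a _.
have := tgeom_ge0 a; case: ifP; case: ifP => //; lia.
Qed.
End Geometric.

Section Window.
Variables (R : realFieldType) (q : R) (s h : nat) (I : finType).
Hypothesis q01 : 0 <= q <= 1.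
Hypothesis hs : (h <= s)%N.
Let O := {ffun I -> 'I_s.+1}.
Let pr := mass (@prodw R I _ (tgeom q (s:=s))).

(** For the variables [v] in [vs] and offsets [a v], this is the event
    0 <= max_v (w v - a v) < h. *)
Definition max_window (vs : seq I) (a : I -> nat) : {set O} :=
  [set w : O | has (fun v => (a v <= w v)%N) vs
             && all (fun v => (w v < a v + h)%N) vs].

(** The first variable of the list to reach its offset must then stay below the
    offset plus [h], which has conditional probability at most [1 - q ^+ h] up
    to truncation. *)
Lemma pr_max_window (vs : seq I) (a : I -> nat) (X : {set O}) :
  uniq vs -> (forall v, v \in vs -> free_of v X) ->
  pr (X :&: max_window vs a)
    <= (1 - q ^+ h + (size vs)%:R * q ^+ (s - h)) * pr X.
Proof.
have W0 (w : O) : 0 <= prodw (tgeom q (s:=s)) w.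
  by apply: prodw_ge0 => b; exact: tgeom_ge0.
have pr0 Y : 0 <= pr Y by exact: mass_ge0.
have qh : 0 <= 1 - q ^+ h by case/andP: q01 => *; rewrite subr_ge0 exprn_ile1.
have qs : 0 <= q ^+ (s - h) by case/andP: q01 => *; rewrite exprn_ge0.
elim: vs X => [|v vs IH] X /=.
  move=> _ _; rewrite mul0r addr0.
  rewrite (_ : X :&: _ = finset.set0); last by apply/setP => w; rewrite !inE /= andbF.
  have -> : pr finset.set0 = 0 by rewrite /pr /mass big_set0.
  exact: mulr_ge0.
case/andP=> vvs uvs hX.
have hXv : free_of v X by apply: hX; rewrite mem_head.
pose Y1 := [set w : O | (a v <= w v)%N].
rewrite {1}/pr (@massID _ _ (prodw _) _ Y1) -!/(pr _).
have e1 : pr (X :&: max_window (v :: vs) a :&: Y1)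
    <= (1 - q ^+ h) * pr (X :&: Y1) + q ^+ (s - h) * pr X.
  apply: le_trans (_ : _ <= pr (X :&: [set w : O | (a v <= w v < a v + h)%N])) _.
    apply: massS => //; apply/fintype.subsetP => w; rewrite !inE /=.
    by case/andP=> /andP[-> /and3P[_ -> _]] ->.
  rewrite /pr (mass_indep (tgeom_sum1 s q01) (fun b : 'I__ => (a v <= b < a v + h)%N)) //.
  rewrite (mass_indep (tgeom_sum1 s q01) (fun b : 'I__ => (a v <= b)%N)) //.
  rewrite -/(pr _) mulrCA [q ^+ _ * _]mulrC -mulrDr ler_wpM2l //.
  exact: tgeom_window.
have e2 : pr (X :&: max_window (v :: vs) a :\: Y1)
    <= (1 - q ^+ h + (size vs)%:R * q ^+ (s - h)) * pr (X :\: Y1).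
  apply: le_trans (_ : _ <= pr ((X :\: Y1) :&: max_window vs a)) _.
    apply: massS => //; apply/fintype.subsetP => w; rewrite !inE /=.
    by case/andP=> /negPf -> /= /and3P[-> -> /andP[_ ->]].
  apply: IH => // v' v'vs.
  have -> : X :\: Y1 = X :&: [set w : O | ~~ (a v <= w v)%N].
    by apply/setP => w; rewrite !inE andbC.
  apply: free_ofI; first by apply: hX; rewrite inE v'vs orbT.
  apply: (@free_of_coord _ _ _ _ (fun b : 'I_s.+1 => ~~ (a v <= b)%N)).
  by apply: contraNneq vvs => <-.
apply: le_trans (lerD e1 e2) _.
have -> : pr X = pr (X :&: Y1) + pr (X :\: Y1) by exact: massID.
rewrite -natr1.
have : 0 <= (size vs)%:R * q ^+ (s - h) * pr (X :&: Y1) by rewrite !mulr_ge0.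
lra.
Qed.
End Window.

(** * Separation at one scale *)

Section ShiftedMax.
Variables (R : realFieldType) (V : choiceType) (d : V -> V -> nat).
Hypothesis d0 : forall x, d x x = 0%N.
Hypothesis dC : forall x y, d x y = d y x.
Hypothesis dtri : forall x y z, (d x z <= d x y + d y z)%N.
Variables (S : seq V) (n s : nat).

Let I := ('I_n * seq_sub S)%type.
Let O := {ffun I -> 'I_s.+1}.

(** The random functions phi_i(x) = max_z (w(i,z) - d(x,z)); the truncated
    subtraction makes them vanish when all these differences are negative. *)
Definition smax (w : {ffun 'I_n * seq_sub S -> 'I_s.+1}) (i : 'I_n) (x : V) : nat :=
  \max_(z : seq_sub S) (w (i, z) - d x (val z)).

Lemma smax_le w i x : (smax w i x <= s)%N.
Proof. by apply/bigmax_leqP => z _; rewrite (leq_trans (leq_subr _ _)) // -ltnS. Qed.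

Lemma smax_lip w i x y : (smax w i x <= smax w i y + d x y)%N.
Proof.
apply/bigmax_leqP => z _; have := dtri y x (val z); rewrite (dC y x).
have := @leq_bigmax _ (fun z : seq_sub S => w (i, z) - d y (val z))%N z.
rewrite -/(smax w i y) /=; move: (nat_of_ord (w _)); lia.
Qed.

Lemma smax_upd w i x v a : (v.1 != i) || (s <= d x (val v.2))%N ->
  smax (upd w v a) i x = smax w i x.
Proof.
move=> vi; apply: eq_bigr => z _; rewrite ffunE; case: eqP => // ev.
move: vi; rewrite -ev /= eqxx /= => sd.
by have := ltn_ord (w (i, z)); have := ltn_ord a; move: (nat_of_ord (w _)) (nat_of_ord a); lia.
Qed.

Lemma free_of_smax i x v (B : pred nat) : (v.1 != i) || (s <= d x (val v.2))%N ->
  free_of v [set w : O | B (smax w i x)].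
Proof. by move=> vi w a; rewrite !inE smax_upd. Qed.

(** For t = 0 the witness is z = x, which is why [x] has to lie in [S]. *)
Lemma leq_smax (w : O) i x t : x \in S ->
  (t <= smax w i x)%N ->
  exists2 z : seq_sub S, (d x (val z) <= s)%N & (t + d x (val z) <= w (i, z))%N.
Proof.
move=> xS; case: t => [|t] tw.
  by exists (SeqSub xS); rewrite /= d0 // add0n.
have S0 : (0 < #|{: seq_sub S}|)%N by apply/card_gt0P; exists (SeqSub xS).
have [z zE] := @bigop.eq_bigmax _ (fun z : seq_sub S => w (i, z) - d x (val z))%N S0.
exists z; move: tw; rewrite /smax zE; have := ltn_ord (w (i, z)); move: (nat_of_ord (w _)); lia.
Qed.

Variables (q : R) (h N D dg : nat).
Hypothesis q01 : 0 <= q <= 1.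
Hypothesis hs : (2 * h <= s)%N.

Let pr := mass (@prodw R I _ (tgeom q (s:=s))).
(* Being at distance less than h from a given real leaves a window of length 2h. *)
Let p1 := 1 - q ^+ (2 * h)%N + N%:R * q ^+ (s - 2 * h)%N.

Let W0 (w : O) : 0 <= prodw (tgeom q (s:=s)) w.
Proof. by apply: prodw_ge0 => b; exact: tgeom_ge0. Qed.

Let pr0 (Y : {set O}) : 0 <= pr Y. Proof. exact: mass_ge0. Qed.

Let p1_ge0 : 0 <= p1.
Proof.
by case/andP: q01 => *; rewrite addr_ge0 ?mulr_ge0 ?exprn_ge0 ?subr_ge0 ?exprn_ile1.
Qed.

Hypothesis ballN : forall x, x \in S ->
  (#|[set z : seq_sub S | d x (val z) <= s]| <= N)%N.

(** The variables on which phi_i(x) depends. *)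
Definition near_vars i x : seq I :=
  [seq (i, z) | z <- enum [set z : seq_sub S | d x (val z) <= s]%N].

Lemma pr_smax_window i x (r : R) (X : {set O}) : x \in S ->
  (forall z : seq_sub S, (d x (val z) <= s)%N -> free_of (i, z) X) ->
  pr (X :&: [set w : O | `|(smax w i x)%:R - r| < h%:R]) <= p1 * pr X.
Proof.
move=> xS hX.
pose Q k := `|k%:R - r| < h%:R.
have [kS|kN] := boolP [exists w : O, Q (smax w i x)]; last first.
  rewrite (_ : X :&: _ = finset.set0); last first.
    apply/setP => w; rewrite !inE; apply/negP => /andP[_ kw].
    by move/existsP: kN; apply; exists w.
  by rewrite /pr [mass _ finset.set0]big_set0 mulr_ge0.
have exQ : exists k, Q k by case/existsP: kS => w kw; exists (smax w i x).
(* The natural numbers at distance less than h from r lie in [t, t + 2h[. *)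
case: (ex_minnP exQ) => t Qt tmin.
pose a (v : I) := (t + d x (val v.2))%N.
have hs2 : (2 * h <= s)%N by [].
apply: le_trans (_ : _ <= pr (X :&: max_window s (2 * h)%N (near_vars i x) a)) _.
  apply: massS => //; apply/fintype.subsetP => w; rewrite !inE => /andP[-> Qw] /=.
  have tw : (t <= smax w i x)%N by exact: tmin.
  have wt : (smax w i x < t + 2 * h)%N.
    rewrite -(ltr_nat R) natrD natrM.
    by move: Qt Qw; rewrite /Q !ltr_norml => /andP[? _] /andP[_ ?]; lra.
  apply/andP; split.
    have [z dz tz] := leq_smax xS tw.
    by apply/hasP; exists (i, z) => //; apply: map_f; rewrite mem_enum inE.
  apply/allP => _ /mapP[z _ ->]; rewrite /a /=.
  have := @leq_bigmax _ (fun z : seq_sub S => w (i, z) - d x (val z))%N z.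
  by rewrite -/(smax w i x) /=; move: (nat_of_ord (w _)); lia.
apply: le_trans (pr_max_window q01 hs2 _ _ _) _.
- by rewrite map_inj_uniq ?enum_uniq // => z z' [].
- by move=> v /mapP[z zU ->]; apply: hX; move: zU; rewrite mem_enum inE.
rewrite ler_wpM2r // lerD2l ler_wpM2r ?exprn_ge0 //; first by case/andP: q01.
by rewrite ler_nat size_map -cardE ballN.
Qed.

(** As [pr_smax_window], with r replaced by the random r + phi_i(y), which does
    not depend on the variables near [x] because [y] is far from [x]. *)
Lemma pr_smax_diff i x y (r : R) (X : {set O}) : x \in S -> (2 * s < d x y)%N ->
  (forall z : seq_sub S, (d x (val z) <= s)%N -> free_of (i, z) X) ->
  pr (X :&: [set w : O | `|(smax w i x)%:R - (smax w i y)%:R - r| < h%:R]) <= p1 * pr X.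
Proof.
move=> xS sxy hX.
have part (Y : {set O}) :
    pr Y = \sum_(c < s.+1) pr (Y :&: [set w : O | smax w i y == c]).
  rewrite {1}/pr /mass.
  rewrite (partition_big (fun w : O => inord (smax w i y) : 'I_s.+1) predT) //=.
  apply: eq_bigr => c _; apply: eq_bigl => w; rewrite !inE -val_eqE /= inordK //.
  by rewrite ltnS smax_le.
rewrite (part X) mulr_sumr part; apply: ler_sum => c _.
pose X' := X :&: [set w : O | smax w i y == c].
apply: le_trans (_ : _ <=
    pr (X' :&: [set w : O | `|(smax w i x)%:R - ((c : nat)%:R + r)| < h%:R])) _.
  apply: massS => //; apply/fintype.subsetP => w; rewrite !inE.
  by case/andP=> /andP[-> +] /eqP <-; rewrite eqxx opprD addrA.
apply: pr_smax_window => // z dz; apply: free_ofI; first exact: hX.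
apply: (@free_of_smax _ _ _ (fun k => k == c)) => /=; apply/orP; right.
by move: dz (dtri x (val z) y) => /=; rewrite (dC y); lia.
Qed.

Hypothesis degN : forall x, x \in S ->
  (#|[set z : seq_sub S | d x (val z) <= 2 * s + D]| ^ 2 <= dg)%N.
Hypothesis dg_gt0 : (0 < dg)%N.
Hypothesis p1_small : 4 * p1 ^+ n * dg%:R <= 1.

Variable t : 'I_n -> V -> V -> R.

(** No coordinate separates the pair [j] by [h]; void unless the distance of the
    pair is in the range under consideration. *)
Definition scale_bad (j : seq_sub S * seq_sub S) : {set O} :=
  let: (x, y) := (val j.1, val j.2) in
  if (2 * s < d x y <= D)%N then
    [set w : O | [forall i, `|(smax w i x)%:R - (smax w i y)%:R - t i x y| < h%:R]]
  else finset.set0.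

(** Both points of the pair [k] are close to the first point of [j].  Outside this
    relation, [scale_bad k] does not depend on the variables near that point, and
    conditioning on all other variables suffices to bound [scale_bad j]. *)
Definition scale_nb (j k : seq_sub S * seq_sub S) : bool :=
  (d (val j.1) (val k.1) <= 2 * s + D)%N && (d (val j.1) (val k.2) <= 2 * s + D)%N.

Lemma scale_nb_le j : (#|[set k | scale_nb j k]| <= dg)%N.
Proof.
apply: leq_trans (degN (valP j.1)).
set B := [set z | _]; rewrite -mulnn -cardsX; apply: subset_leq_card.
by apply/fintype.subsetP => k; rewrite !inE.
Qed.

Lemma scale_bad_indep j (T : {set seq_sub S * seq_sub S}) :
  (forall k, k \in T -> ~~ scale_nb j k) ->
  pr (scale_bad j :&: avoid scale_bad T) <= p1 ^+ n * pr (avoid scale_bad T).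
Proof.
move=> jT; rewrite /scale_bad; case: ifP => [/andP[sxy xyD]|_]; last first.
  by rewrite finset.set0I /pr [mass _ finset.set0]big_set0 mulr_ge0 ?exprn_ge0.
set x := val j.1 in sxy xyD jT *; set y := val j.2 in sxy xyD *.
have xS : x \in S by exact: (valP j.1).
set X := avoid _ T.
have Xfree i z : (d x (val z) <= s)%N -> free_of (i, z) X.
  move=> dz w a; rewrite !inE; apply: eq_forallb => k.
  have [kT|//] := boolP (k \in T); rewrite !implyTb; congr negb.
  case: ifP => [/andP[sk kD]|_]; rewrite !inE //.
  have := jT k kT; rewrite /scale_nb => nb.
  have [h1 h2] : (s <= d (val k.1) (val z))%N /\ (s <= d (val k.2) (val z))%N.
    have := dtri x (val z) (val k.1); have := dtri x (val z) (val k.2).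
    have := dtri x (val k.1) (val k.2); have := dtri x (val k.2) (val k.1).
    rewrite (dC (val k.2) (val k.1)) (dC (val z) (val k.1)) (dC (val z) (val k.2)).
    move: nb sk kD dz; rewrite -/x /= negb_and -!ltnNge. by case/orP; split; lia.
  by apply: eq_forallb => i'; rewrite !smax_upd //= ?h1 ?h2 orbT.
pose E i := [set w : O | `|(smax w i x)%:R - (smax w i y)%:R - t i x y| < h%:R].
(* The coordinates of l fail one after the other, each with conditional
   probability at most p1. *)
have step (l : seq 'I_n) : uniq l ->
    pr (X :&: [set w : O | all (fun i => w \in E i) l]) <= p1 ^+ size l * pr X.
  elim: l => [_|i l IH /=/andP[il ul]].
    by rewrite mul1r; apply: massS => //; exact: finset.subsetIl.
  rewrite exprS -mulrA; apply: le_trans (ler_wpM2l p1_ge0 (IH ul)).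
  set X' := X :&: [set w : O | all (fun i => w \in E i) l].
  rewrite (_ : X :&: _ = X' :&: E i); last first.
    apply/setP => w; rewrite 3!finset.in_setI -andbA; congr (_ && _).
    by rewrite [in LHS]inE [in RHS]inE /= andbC.
  apply: pr_smax_diff => // z dz; apply: free_ofI; first exact: Xfree.
  move=> w a; rewrite !inE; apply: eq_in_all => i' i'l; rewrite !inE.
  by rewrite !smax_upd //=; apply/orP; left; apply: contraNneq il => ->.
have := step _ (enum_uniq 'I_n); rewrite size_enum_ord; apply: le_trans.
apply: massS => //; apply/fintype.subsetP => w; rewrite !inE => /andP[/forallP hw ->] /=.
by apply/allP => i _; rewrite inE.
Qed.

(** There are [n] bounded 1-Lipschitz functions such that, for every pair of
    points of [S] at distance in ]2s, D], some difference phi_i(x) - phi_i(y) is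
    at distance at least [h] from the arbitrary value t_i(x,y). *)
Lemma one_scale : exists phi : 'I_n -> V -> nat,
  [/\ forall i x, (phi i x <= s)%N,
      forall i x y, (phi i x <= phi i y + d x y)%N &
      forall x y, x \in S -> y \in S -> (2 * s < d x y <= D)%N ->
        exists i, h%:R <= `|(phi i x)%:R - (phi i y)%:R - t i x y|].
Proof.
have : 0 < pr (avoid scale_bad finset.setT).
  apply: (local_lemma W0 _ dg_gt0 p1_small scale_nb_le scale_bad_indep).
    exact: exprn_ge0.
  by rewrite mass_prodwT //; exact: tgeom_sum1.
have [->|/finset.set0Pn[w]] := eqVneq (avoid scale_bad finset.setT) finset.set0.
  by rewrite /pr [mass _ finset.set0]big_set0 ltxx.
rewrite in_avoid => /forall_inP wgood _.
exists (smax w); split; [exact: smax_le | exact: smax_lip |].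
move=> x y xS yS xyD; have := wgood (SeqSub xS, SeqSub yS) (finset.in_setT _).
rewrite /scale_bad /= xyD inE negb_forall => /existsP[i].
by rewrite -leNgt => ?; exists i.
Qed.

End ShiftedMax.

(** * Choice of the parameters at one scale *)

Lemma leq_expl a b k : (a <= b -> a ^ k <= b ^ k)%N.
Proof. by case: k => // k ab; rewrite leq_exp2r. Qed.

Section Bernoulli.
Variable R : realFieldType.
Implicit Types x : R.

(** Bernoulli's inequality for positive and for negative increments. *)
Lemma bernoulli x k : 0 <= x -> 1 + k%:R * x <= (1 + x) ^+ k.
Proof.
move=> x0; elim: k => [|k IH]; first by rewrite mul0r addr0.
rewrite exprS -natr1 (le_trans _ (ler_wpM2l _ IH)) ?addr_ge0 //.
have : 0 <= k%:R * x * x by rewrite !mulr_ge0.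
lra.
Qed.

Lemma bernoulliN x k : 0 <= x <= 1 -> 1 - k%:R * x <= (1 - x) ^+ k.
Proof.
case/andP=> x0 x1; elim: k => [|k IH]; first by rewrite mul0r subr0.
rewrite exprS -natr1 (le_trans _ (ler_wpM2l _ IH)) ?subr_ge0 //.
have : 0 <= k%:R * x * x by rewrite !mulr_ge0.
lra.
Qed.

Lemma expr_half k : (0 < k)%N -> (1 - k%:R^-1) ^+ k <= 2^-1 :> R.
Proof.
move=> k0; have kR : 0 < k%:R :> R by rewrite ltr0n.
have k1 : 1 <= k%:R :> R by rewrite ler1n.
set x := k%:R^-1; have x0 : 0 <= x by rewrite invr_ge0 ltW.
have x1 : x <= 1 by rewrite invf_le1.
have := bernoulli k x0; rewrite divff ?gt_eqF // => h2.
have hx : (1 - x) ^+ k * (1 + x) ^+ k <= 1.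
  by rewrite -exprMn exprn_ile1 //; nra.
have : 0 <= (1 - x) ^+ k by rewrite exprn_ge0 ?subr_ge0.
nra.
Qed.
End Bernoulli.

Section ScaleNumerics.
Variables (R : realFieldType) (P m e : nat).
Hypothesis m7 : (7 <= m)%N.
Hypothesis e4 : (4 <= e)%N.

(** At the scale of exponent [e], put b = 2^e.  The functions take values up to
    b^m, they separate by b^(m-2), and the ratio of the geometric law is
    1 - b^-(m-1); [scale_dim] is the number of coordinates. *)
Definition scale_range := (2 ^ (m * e))%N.
Definition scale_gap := (2 ^ ((m - 2) * e))%N.
Definition scale_ratio : R := 1 - (2 ^ ((m - 1) * e))%:R^-1.
Definition scale_dim := (8 * P * m + 8 * P + 4)%N.

Lemma scale_ratio01 : 0 <= scale_ratio <= 1.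
Proof.
have B1 : 1 <= (2 ^ ((m - 1) * e))%:R :> R by rewrite ler1n expn_gt0.
have B0 : 0 < (2 ^ ((m - 1) * e))%:R :> R by apply: lt_le_trans B1.
by rewrite /scale_ratio subr_ge0 invf_le1 // B1 lerBlDr lerDl invr_ge0 ltW.
Qed.

Lemma scale_gap_step : (2 * scale_gap <= 2 ^ ((m - 1) * e))%N.
Proof. by rewrite /scale_gap -expnS leq_exp2l //; nia. Qed.

Lemma scale_gap_range : (2 * scale_gap <= scale_range)%N.
Proof. by apply: leq_trans scale_gap_step _; rewrite leq_exp2l //; nia. Qed.

Hypothesis e_large : (P * (m * e + 1) + e + 1 <= 2 ^ e)%N.

(** The failure probability of one coordinate is at most 4/b. *)
Lemma scale_fail_prob : 1 - scale_ratio ^+ (2 * scale_gap)%N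
  + ((scale_range.+1) ^ P)%:R * scale_ratio ^+ (scale_range - 2 * scale_gap)%N
  <= (2 ^ (e - 2))%:R^-1.
Proof.
pose b := (2 ^ e)%N; pose B := (2 ^ ((m - 1) * e))%N.
have B0 : 0 < B%:R :> R by rewrite ltr0n expn_gt0.
have b0 : 0 < b%:R :> R by rewrite ltr0n expn_gt0.
have sB : scale_range = (B * b)%N by rewrite /scale_range /B /b -expnD; congr expn; nia.
have BE : B = (scale_gap * b)%N by rewrite /scale_gap /B /b -expnD; congr expn; nia.
have b1 : (0 < b)%N by rewrite expn_gt0.
have /andP[q0 q1] := scale_ratio01.
have t1 : 1 - scale_ratio ^+ (2 * scale_gap)%N <= 2 * b%:R^-1.
  have := @bernoulliN R B%:R^-1 (2 * scale_gap)%N.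
  rewrite -/scale_ratio => /(_ _) h.
  have {h} : 1 - (2 * scale_gap)%:R * B%:R^-1 <= scale_ratio ^+ (2 * scale_gap)%N.
    by apply: h; rewrite invr_ge0 ltW //= invf_le1 // ler1n expn_gt0.
  have -> : (2 * scale_gap)%:R * B%:R^-1 = 2 * b%:R^-1 :> R.
    have h0 : scale_gap%:R != 0 :> R by rewrite pnatr_eq0 -lt0n expn_gt0.
    by rewrite BE !natrM; field; rewrite h0 gt_eqF.
  lra.
have t2 : scale_ratio ^+ (scale_range - 2 * scale_gap)%N <= (2 ^ (b - 1))%:R^-1.
  apply: le_trans (_ : scale_ratio ^+ (B * (b - 1))%N <= _).
    by apply: ler_wiXn2l => //; have := scale_gap_step; rewrite -/B sB; nia.
  rewrite exprM natrX -exprVn; apply: lerXn2r; rewrite ?nnegrE ?exprn_ge0 ?invr_ge0 //.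
  by apply: expr_half; rewrite expn_gt0.
have t3 : ((scale_range.+1) ^ P)%:R * scale_ratio ^+ (scale_range - 2 * scale_gap)%N <= b%:R^-1.
  apply: le_trans (ler_wpM2l _ t2) _; first by [].
  have c0 : 0 < (2 ^ (b - 1))%:R :> R by rewrite ltr0n expn_gt0.
  rewrite ler_pdivrMr // mulrC ler_pdivlMr // -natrM ler_nat.
  apply: leq_trans (_ : (2 ^ ((m * e + 1) * P)) * b <= _)%N.
    rewrite leq_mul2r expnM leq_expl ?orbT // /scale_range addn1 expnS.
    by have := expn_gt0 2 (m * e); lia.
  rewrite /b -expnD leq_exp2l //; rewrite -/b; nia.
have t4 : (2 ^ (e - 2))%:R^-1 = 4 * b%:R^-1 :> R.
  have -> : b = (4 * 2 ^ (e - 2))%N by rewrite /b -(expnD 2 2); congr expn; lia.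
  have h0 : (2 ^ (e - 2))%:R != 0 :> R by rewrite pnatr_eq0 -lt0n expn_gt0.
  by rewrite natrM; field.
have : 0 <= b%:R^-1 :> R by rewrite invr_ge0 ltW.
rewrite t4; lra.
Qed.

(** The condition of the local lemma, for distances up to [D]: a ball of radius
    2s + D has at most (4 b^(2m))^P points, and the exponent [scale_dim] of 4/b
    outweighs the square of this number. *)
Lemma scale_local_lemma_cond D (p1 : R) : 0 <= p1 <= (2 ^ (e - 2))%:R^-1 ->
  (D <= 2 * 2 ^ (m * (2 * e)))%N ->
  4 * p1 ^+ scale_dim * (((2 * scale_range + D).+1 ^ P) ^ 2)%:R <= 1.
Proof.
case/andP=> p0 pe De.
have c0 : 0 < (2 ^ (e - 2))%:R :> R by rewrite ltr0n expn_gt0.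
have h1 : p1 ^+ scale_dim <= (2 ^ ((e - 2) * scale_dim))%:R^-1.
  rewrite expnM natrX -exprVn; apply: lerXn2r; rewrite ?nnegrE ?invr_ge0 //.
rewrite mulrAC; apply: le_trans (ler_wpM2l _ h1) _; first by rewrite mulr_ge0.
rewrite ler_pdivrMr ?ltr0n ?expn_gt0 // mul1r -natrM ler_nat.
apply: leq_trans (_ : 2 ^ (2 + (2 * m * e + 2) * P * 2) <= _)%N; last first.
  rewrite leq_exp2l // /scale_dim; nia.
rewrite expnD leq_mul2l /= !expnM.
do 2 apply: leq_expl; rewrite /scale_range mulnA (mulnC m) -mulnA in De *.
apply: leq_trans (_ : 4 * 2 ^ (2 * (m * e)) <= _)%N; last first.
  by rewrite -(expnD 2 2) leq_exp2l //; lia.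
have : (2 ^ (m * e) < 2 ^ (2 * (m * e)))%N by rewrite ltn_exp2l //; nia.
lia.
Qed.
End ScaleNumerics.

(** * The sequence of scales *)

Section Exponents.
Variables (m e0 : nat).

(** The exponents e_k, which grow by the factor 1 + 7/m up to rounding. *)
Fixpoint scale_exp k : nat := if k is k'.+1 then (scale_exp k' + 7 * (scale_exp k' %/ m))%N else e0.

Hypothesis m14 : (14 <= m)%N.
Hypothesis me0 : (3 * m <= e0)%N.

Lemma scale_exp_ge k : (e0 + k <= scale_exp k)%N.
Proof.
elim: k => [|k IH] /=; first by rewrite addn0.
have : (0 < scale_exp k %/ m)%N by rewrite divn_gt0; lia.
lia.
Qed.

Lemma scale_exp_le k : (m * scale_exp k.+1 <= (m + 7) * scale_exp k)%N.
Proof. by have := leq_trunc_div (scale_exp k) m => /=; nia. Qed.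

Lemma scale_exp_dbl k : (scale_exp k.+1 <= 2 * scale_exp k)%N.
Proof. by have := scale_exp_le k; nia. Qed.

(** The growth factor 1 + 7/m beats m/(m-3), with room for the rounding. *)
Lemma scale_exp_growth k : (m * scale_exp k + 2 <= (m - 3) * scale_exp k.+1)%N.
Proof.
have e3 : (3 * m <= scale_exp k)%N by have := scale_exp_ge k; lia.
have m0 : (0 < m)%N by lia.
have := ltn_ceil (scale_exp k) m0 => /=; move: (scale_exp k) e3 => e e3.
have : (3 <= e %/ m)%N by rewrite leq_divRL //.
move: (e %/ m)%N => f.
rewrite mulnBl; nia.
Qed.

(** The k-th term s_k / 2^(e_k) is 2^((m-1) e_k); all scales below the k-th sum up
    to at most a quarter of the separation 2^((m-3) e_k) at scale k. *)
Lemma lower_scales_sum k :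
  (4 * \sum_(0 <= j < k) 2 ^ ((m - 1) * scale_exp j) <= 2 ^ ((m - 3) * scale_exp k))%N.
Proof.
elim: k => [|k IH]; first by rewrite big_geq // muln0.
rewrite big_nat_recr //= mulnDr.
apply: leq_trans (leq_pexp2l _ (scale_exp_growth k)) => //.
rewrite expnD.
have -> : (m * scale_exp k = (m - 1) * scale_exp k + scale_exp k)%N by nia.
have : (2 ^ ((m - 3) * scale_exp k) <= 2 ^ ((m - 1) * scale_exp k))%N by rewrite leq_exp2l //; nia.
have : (4 <= 2 ^ scale_exp k)%N.
  apply: leq_trans (_ : 2 ^ 2 <= _)%N; rewrite ?leq_exp2l //.
  by have := scale_exp_ge k; lia.
rewrite expnD; nia.
Qed.

(** Every distance above 2 s_0 belongs to one of the ranges ]2 s_k, 2 s_(k+1)]. *)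
Lemma exists_scale d : (2 * scale_range m (scale_exp 0) < d)%N ->
  exists k, (2 * scale_range m (scale_exp k) < d <= 2 * scale_range m (scale_exp k.+1))%N.
Proof.
move=> d0; have ex : exists k, (d <= 2 * scale_range m (scale_exp k))%N.
  exists d; apply: leq_trans (_ : scale_range m (scale_exp d) <= _)%N; last by lia.
  apply: leq_trans (ltnW (ltn_expl _ (ltnSn 1))) _; rewrite leq_exp2l //.
  by have := scale_exp_ge d; nia.
case: (ex_minnP ex) => -[|k] dk kmin; first by move: d0; rewrite ltnNge dk.
exists k; rewrite dk andbT ltnNge; apply/negP => /kmin; lia.
Qed.
End Exponents.

Lemma sum_half_pow (R : realFieldType) (e : nat -> nat) K :
  (forall k, (k < e k)%N) ->
  \sum_(0 <= j < K) (2 ^ e j)%:R^-1 <= 1 :> R.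
Proof.
move=> ke; apply: le_trans (_ : 1 - (2 ^ K)%:R^-1 <= _); last first.
  by rewrite lerBlDr lerDl invr_ge0.
elim: K => [|K IH]; first by rewrite big_geq // invr1 subrr.
rewrite big_nat_recr //=; apply: le_trans (lerD IH (lexx _)) _.
have p0 (i : nat) : 0 < (2 ^ i)%:R :> R by rewrite ltr0n expn_gt0.
have : (2 ^ e K)%:R^-1 <= (2 ^ K.+1)%:R^-1 :> R.
  by rewrite lef_pV2 ?posrE // ler_nat leq_exp2l.
rewrite expnS natrM invfM; lra.
Qed.

Section Floor.
Variable R : archiRealFieldType.
Implicit Types a b : R.

Lemma floor_dist_le a b (k : nat) :
  `|a - b| <= k%:R -> `|Num.floor a - Num.floor b| <= k%:Z.
Proof.
have le1 u v : u - v <= k%:R :> R -> Num.floor u - Num.floor v <= k%:Z.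
  move=> uv; rewrite -ltzD1 -(ltr_int R) !intrD rmorphN /= -pmulrn.
  have := floor_le u; have := floorD1_gt v; rewrite intrD; lra.
rewrite !ler_norml => /andP[h1 h2]; rewrite le1 // andbT.
by rewrite lerNl opprB le1 //; lra.
Qed.

Lemma floor_dist_gt a b : `|a - b| - 1 < `|Num.floor a - Num.floor b|%:~R.
Proof.
rewrite intr_norm rmorphB /=.
have := floor_le a; have := floor_le b.
have := floorD1_gt a; have := floorD1_gt b; rewrite !intrD.
move: ((Num.floor a)%:~R : R) ((Num.floor b)%:~R : R) => fa fb h1 h2 h3 h4.
have := ler_norm (fa - fb); have := ler_norm (fb - fa); rewrite (distrC fb).
rewrite ltrBlDr ltr_norml => h5 h6; apply/andP; split; lra.
Qed.
End Floor.

(** * Embedding a finite set of far pairs *)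

Section MultiScale.
Variables (R : archiRealFieldType) (V : choiceType) (d : V -> V -> nat).
Hypothesis d0 : forall x, d x x = 0%N.
Hypothesis dC : forall x y, d x y = d y x.
Hypothesis dtri : forall x y z, (d x z <= d x y + d y z)%N.
Variables (P m e0 : nat).
Hypothesis pack : forall x r (t : seq V), (1 <= r)%N -> uniq t ->
  (forall y, y \in t -> (d x y <= r)%N) -> (size t <= r.+1 ^ P)%N.
Hypothesis m14 : (14 <= m)%N.
Hypothesis me0 : (3 * m <= e0)%N.
Hypothesis e_large : forall e, (e0 <= e)%N -> (P * (m * e + 1) + e + 1 <= 2 ^ e)%N.
Variable S : seq V.

Let n := scale_dim P m.
Let ex := scale_exp m e0.
Let sk k := scale_range m (ex k).
Let hk k := scale_gap m (ex k).

Let m7 : (7 <= m)%N. Proof. by lia. Qed.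
Let ex_ge k : (e0 + k <= ex k)%N. Proof. exact: scale_exp_ge. Qed.

Lemma pack_card x r : (1 <= r)%N ->
  (#|[set z : seq_sub S | d x (val z) <= r]| <= r.+1 ^ P)%N.
Proof.
move=> r1; rewrite cardE -(size_map val); apply: (pack (x := x)) => //.
  by rewrite map_inj_uniq ?enum_uniq //; exact: val_inj.
by move=> y /mapP[z]; rewrite mem_enum inE => dz ->.
Qed.

Lemma scale_step k (t : 'I_n -> V -> V -> R) : exists phi : 'I_n -> V -> nat,
  [/\ forall i x, (phi i x <= sk k)%N,
      forall i x y, (phi i x <= phi i y + d x y)%N &
      forall x y, x \in S -> y \in S -> (2 * sk k < d x y <= 2 * sk k.+1)%N ->
        exists i, (hk k)%:R <= `|(phi i x)%:R - (phi i y)%:R - t i x y|].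
Proof.
have e4 : (4 <= ex k)%N by have := ex_ge k; lia.
have el : (P * (m * ex k + 1) + ex k + 1 <= 2 ^ ex k)%N.
  by apply: e_large; have := ex_ge k; lia.
have s1 : (1 <= sk k)%N by rewrite expn_gt0.
apply: (one_scale d0 dC dtri (q := scale_ratio R m (ex k)) (N := ((sk k).+1 ^ P)%N)
  (dg := ((2 * sk k + 2 * sk k.+1).+1 ^ P) ^ 2)%N).
- exact: scale_ratio01.
- exact: scale_gap_range.
- by move=> x _; exact: pack_card.
- by move=> x _; apply: leq_expl; apply: pack_card; lia.
- by rewrite !expn_gt0.
apply: scale_local_lemma_cond => //.
  apply/andP; split; last exact: scale_fail_prob.
  have /andP[q0 q1] := scale_ratio01 R m (ex k).
  by rewrite addr_ge0 ?mulr_ge0 ?exprn_ge0 // subr_ge0 exprn_ile1.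
by rewrite leq_mul2l /= leq_exp2l // leq_mul2l scale_exp_dbl ?orbT.
Qed.

(** The functions of scale [k] are bounded by s_k, 1-Lipschitz, and separate by
    h_k even after the contribution of the scales k+1, ..., K-1, rescaled by
    2^(e_k), is added. *)
Definition good_scale (K : nat) (Phi : nat -> 'I_n -> V -> nat) k :=
  [/\ forall i x, (Phi k i x <= sk k)%N,
      forall i x y, (Phi k i x <= Phi k i y + d x y)%N &
      forall x y, x \in S -> y \in S -> (2 * sk k < d x y <= 2 * sk k.+1)%N ->
        exists i, (hk k)%:R <= `|(Phi k i x)%:R - (Phi k i y)%:R +
          (2 ^ ex k)%:R * \sum_(k.+1 <= j < K)
             ((Phi j i x)%:R - (Phi j i y)%:R) / (2 ^ ex j)%:R : R|].

(** The scales are chosen from the top scale K - 1 down to 0. *)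
Lemma all_scales K : exists Phi : nat -> 'I_n -> V -> nat,
  forall k, (k < K)%N -> good_scale K Phi k.
Proof.
suff: forall c, (c <= K)%N -> exists Phi : nat -> 'I_n -> V -> nat,
    forall k, (K - c <= k < K)%N -> good_scale K Phi k.
  move=> /(_ K (leqnn K))[Phi hPhi]; exists Phi => k kK.
  by apply: hPhi; rewrite subnn.
elim=> [_|c IH cK]; first by exists (fun _ _ _ => 0%N) => k; lia.
have [Phi hPhi] := IH (ltnW cK).
pose k0 := (K - c.+1)%N.
have [phi [phi_le phi_lip phi_sep]] := scale_step k0 (fun i x y =>
  - ((2 ^ ex k0)%:R * \sum_(k0.+1 <= j < K)
             ((Phi j i x)%:R - (Phi j i y)%:R) / (2 ^ ex j)%:R)).
exists (fun k => if k == k0 then phi else Phi k) => k kK.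
have sumE (F : (nat -> 'I_n -> V -> nat) -> nat -> R) k1 Phi' : (k0 <= k1)%N ->
    (forall j, (k0 < j)%N -> F Phi' j = F Phi j) ->
    \sum_(k1.+1 <= j < K) F Phi' j = \sum_(k1.+1 <= j < K) F Phi j.
  by move=> k01 FE; apply: eq_big_nat => j /andP[kj _]; apply: FE; lia.
rewrite /good_scale; have [->|kk0] := eqVneq k k0.
  split=> // x y xS yS /(phi_sep x y xS yS)[i hi]; exists i.
  move: hi; rewrite opprK; congr (_ <= `|_ + _ * _|).
  apply: eq_big_nat => j /andP[kj _]; rewrite ifN //; lia.
have kK' : (K - c <= k < K)%N by lia.
have [h1 h2 h3] := hPhi k kK'.
split=> // x y xS yS /(h3 x y xS yS)[i hi]; exists i.
move: hi; congr (_ <= `|_ + _ * _|).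
apply: eq_big_nat => j /andP[kj _]; rewrite ifN //; lia.
Qed.

(** The integer parts of sum_k phi_k / 2^(e_k) separate the far pairs of [S]. *)
Lemma embed_finite : exists F : 'I_n -> V -> int,
  (forall i x y, `|F i x - F i y| <= (d x y)%:Z) /\
  (forall x y, x \in S -> y \in S -> (2 * sk 0 < d x y)%N ->
    exists k i, (d x y <= 2 ^ ((m + 8) * ex k))%N /\
                (2 ^ ((m - 4) * ex k))%:Z <= `|F i x - F i y|).
Proof.
(* As s_K > K, the scales below K cover all distances between points of S. *)
have [K hK] : exists K, forall x y, x \in S -> y \in S -> (d x y <= 2 * K)%N.
  exists (\max_(x : seq_sub S) \max_(y : seq_sub S) d (val x) (val y)).
  move=> x y xS yS; apply: leq_trans (_ : _ <= _)%N; last exact: leq_pmull.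
  apply: leq_trans (bigop.leq_bigmax (SeqSub xS)).
  exact: (bigop.leq_bigmax (F := fun z : seq_sub S => d x (val z)) (SeqSub yS)).
have [Phi hPhi] := all_scales K.
have p0 (i : nat) : 0 < (2 ^ i)%:R :> R by rewrite ltr0n expn_gt0.
pose G i x : R := \sum_(0 <= j < K) (Phi j i x)%:R / (2 ^ ex j)%:R.
have GB i x y : G i x - G i y =
   \sum_(0 <= j < K) ((Phi j i x)%:R - (Phi j i y)%:R) / (2 ^ ex j)%:R.
  by rewrite /G -sumrB; apply: eq_bigr => j _; rewrite mulrBl.
have Glip i x y : `|G i x - G i y| <= (d x y)%:R.
  rewrite GB; apply: le_trans (ler_norm_sum _ _ _) _.
  apply: le_trans (_ : \sum_(0 <= j < K) (d x y)%:R * (2 ^ ex j)%:R^-1 <= _).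
    apply: ler_sum_nat => j /andP[_ jK]; have [_ lip _] := hPhi j jK.
    rewrite normrM [X in _ * X]ger0_norm ?invr_ge0 // ler_wpM2r ?invr_ge0 //.
    rewrite ler_norml lerBlDr lerNl opprB lerBlDr -!natrD !ler_nat.
    by have := lip i x y; have := lip i y x; rewrite (dC y); lia.
  rewrite -mulr_sumr ler_piMr // sum_half_pow // => k.
  by have := ex_ge k; lia.
exists (fun i x => Num.floor (G i x)); split.
  by move=> i x y; exact: floor_dist_le.
move=> x y xS yS dxy; have [k kP] := exists_scale m14 me0 dxy.
have {kP} /andP[dk dk1] : (2 * sk k < d x y <= 2 * sk k.+1)%N by [].
have kK : (k < K)%N.
  rewrite -(ltn_pmul2l (isT : 0 < 2)%N); apply: leq_trans (hK x y xS yS).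
  apply: leq_trans dk; rewrite ltnS leq_mul2l /= (leq_trans (ltnW (ltn_expl _ (ltnSn 1)))) //.
  by rewrite leq_exp2l //; have := ex_ge k; nia.
have [_ _ /(_ x y xS yS)] := hPhi k kK; rewrite dk dk1 => /(_ isT)[i hi].
exists k, i; split.
  apply: leq_trans dk1 _; rewrite /sk /scale_range -expnS leq_exp2l //.
  by have := scale_exp_le m14 me0 k; rewrite -/ex; have := ex_ge k; lia.
pose X : R := (2 ^ ((m - 3) * ex k))%:R.
pose low := \sum_(0 <= j < k) ((Phi j i x)%:R - (Phi j i y)%:R) / (2 ^ ex j)%:R : R.
have low_le : 4 * `|low| <= X.
  apply: le_trans (_ : (4 * \sum_(0 <= j < k) 2 ^ ((m - 1) * ex j))%:R <= _).
    rewrite natrM ler_wpM2l // natr_sum.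
    apply: le_trans (ler_norm_sum _ _ _) _; apply: ler_sum_nat => j /andP[_ jk].
    have [le_s _ _] := hPhi j (ltn_trans jk kK).
    rewrite normrM [X in _ * X]ger0_norm ?invr_ge0 // ler_pdivrMr // -natrM -expnD.
    have -> : ((m - 1) * ex j + ex j = m * ex j)%N by nia.
    rewrite ler_norml lerBlDr lerNl opprB lerBlDr -!natrD !ler_nat.
    by rewrite !(leq_trans (le_s _ _)) ?leq_addr.
  by rewrite ler_nat lower_scales_sum.
have XE : (hk k)%:R = X * (2 ^ ex k)%:R.
  by rewrite -natrM -expnD; congr (_%:R); congr expn; nia.
have Gge : X - X / 4 <= `|G i x - G i y|.
  rewrite GB (big_cat_nat (n := k)) //=; last exact: ltnW.
  rewrite -/low big_ltn // addrC.
  apply: le_trans (lerB_normD _ _); apply: lerB; last by lra.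
  rewrite -(ler_pM2r (p0 (ex k))) -XE; apply: le_trans hi _.
  have normM (u : R) : `|u| * (2 ^ ex k)%:R = `|u * (2 ^ ex k)%:R|.
    by rewrite normrM [X in _ = _ * X]ger0_norm.
  by rewrite normM mulrDl mulfVK ?gt_eqF // [in leRHS](mulrC (\sum_(_ <= _ < _) _)).
have := floor_dist_gt (G i x) (G i y).
rewrite -(ler_int R) -pmulrn.
have : 4 * (2 ^ ((m - 4) * ex k))%:R <= X.
  rewrite -natrM ler_nat -(expnD 2 2) leq_exp2l //.
  by have := ex_ge k; nia.
have : (1 : R) <= (2 ^ ((m - 4) * ex k))%:R by rewrite ler1n expn_gt0.
move: Gge; set Y : R := _%:R; lra.
Qed.
End MultiScale.

(** * Limits of Lipschitz maps *)

(** A function with finitely many values is constant on a set of the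
    ultrafilter. *)
Lemma ultra_finType (I : Type) (T : finType) (U : set_system I) (g : I -> T) :
  UltraFilter U -> exists a, U [set N | g N = a]%classic.
Proof.
move=> UU; apply: contrapT => noa.
have : U [set N | forall a, g N <> a]%classic.
  apply: filter_forall => a; have [Ua|//] := in_ultra_setVsetC [set N | g N = a]%classic UU.
  by case: noa; exists a.
by move=> /filter_ex[N] /(_ (g N)).
Qed.

(** A sequence of 1-Lipschitz maps to Z^n has a limit whose difference on any two
    points is attained by arbitrarily late maps of the sequence.  Normalised to
    vanish at [x0], the maps take finitely many values at each point, and
    converge along a free ultrafilter. *)
Lemma lipschitz_limit (V : choiceType) (d : V -> V -> nat) (x0 : V) (n : nat)
    (F : nat -> 'I_n -> V -> int) :
  (forall N i x y, `|F N i x - F N i y| <= (d x y)%:Z) ->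
  exists f : 'I_n -> V -> int, forall x y N0, exists2 N, (N0 <= N)%N &
    forall i, f i x - f i y = F N i x - F N i y.
Proof.
move=> lip; have [U [UU sU]] := ultraFilterLemma (eventually_filter).
have lim x i : exists a : int, U [set N | F N i x - F N i x0 = a]%classic.
  pose D := d x x0.
  pose g N : 'I_(2 * D).+1 := inord (absz (F N i x - F N i x0 + D%:Z)).
  have [a Ua] := ultra_finType g UU; exists ((a : nat)%:Z - D%:Z).
  apply: filterS Ua => N /= <-; rewrite /g inordK; have := lip N i x x0; rewrite -/D; lia.
pose f i x := sval (cid (lim x i)).
exists f => x y N0.
have UN0 : U [set N | (N0 <= N)%N]%classic by apply: sU; exists N0.
have Uxy : U [set N | forall i, f i x - f i y = F N i x - F N i y]%classic.
  apply: filter_forall => i.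
  have := svalP (cid (lim x i)); have := svalP (cid (lim y i)).
  move=> Uy Ux; apply: filterS2 Ux Uy => N /= ex ey.
  by rewrite /f -[sval (cid (lim x i))]ex -[sval (cid (lim y i))]ey; ring.
by have [N [h1 h2]] := filter_ex (filterI UN0 Uxy); exists N.
Qed.

(** * Embedding a metric space of polynomial growth *)

Section MetricEmbedding.
Variables (R : realType) (V : choiceType) (d : V -> V -> nat).
Hypothesis d0 : forall x y, (d x y == 0%N) = (x == y).
Hypothesis dC : forall x y, d x y = d y x.
Hypothesis dtri : forall x y z, (d x z <= d x y + d y z)%N.
Variables (P m e0 : nat).
Hypothesis pack : forall x r (t : seq V), (1 <= r)%N -> uniq t ->
  (forall y, y \in t -> (d x y <= r)%N) -> (size t <= r.+1 ^ P)%N.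

(** Greedy colouring: when a point is added, the points of its [r]-ball coloured
    before it leave a colour free, as the ball contains the point itself. *)
Lemma proper_colouring (S : seq V) r n1 : (1 <= r)%N -> (r.+1 ^ P <= 2 ^ n1)%N ->
  exists c : V -> {ffun 'I_n1 -> bool}, forall x y, x \in S -> y \in S ->
    x != y -> (d x y <= r)%N -> c x != c y.
Proof.
move=> r1 rn1; elim: S => [|x S [c hc]]; first by exists (fun _ => [ffun=> false]).
have [xS|xS] := boolP (x \in S).
  by exists c => y z; rewrite !inE => /predU1P[->|yS] /predU1P[->|zS]; apply: hc.
pose N := undup [seq y <- S | (d x y <= r)%N].
have sN : (size N < 2 ^ n1)%N.
  apply: leq_trans rn1; rewrite -[(size N).+1]/(size (x :: N)); apply: (pack (x := x)) => //.
    by rewrite /= undup_uniq mem_undup mem_filter (negPf xS) andbF.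
  move=> y; rewrite inE mem_undup mem_filter => /predU1P[->|/andP[]//].
  by have := d0 x x; rewrite eqxx => /eqP ->.
have [a aN] : exists a, a \notin [seq c y | y <- N].
  apply/existsP; apply: contraLR sN; rewrite negb_exists => /forallP aN.
  rewrite -leqNgt -(size_map c) -[n1 in leqLHS]card_ord -card_bool -card_ffun.
  rewrite (leq_trans _ (card_size _)) //; apply/subset_leq_card/fintype.subsetP => a _.
  by have := aN a; rewrite negbK.
have aP y : y \in S -> (d x y <= r)%N -> a != c y.
  move=> yS dy; apply: contraNneq aN => ->; apply: map_f.
  by rewrite mem_undup mem_filter dy.
exists (fun y => if y == x then a else c y) => y z; rewrite !inE.
have [->|yx] := eqVneq y x; have [->|zx] := eqVneq z x; rewrite ?eqxx //=.
- by move=> _ zS _; exact: aP.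
- by move=> yS _ _; rewrite dC eq_sym; exact: aP.
- exact: hc.
Qed.

Hypothesis m14 : (14 <= m)%N.
Hypothesis me0 : (3 * m <= e0)%N.
Hypothesis e_large : forall e, (e0 <= e)%N -> (P * (m * e + 1) + e + 1 <= 2 ^ e)%N.

Let n1 := (P * (m * e0 + 2))%N.
Let n2 := scale_dim P m.
Let s0 := (2 ^ (m * e0))%N.

(** The two lower bounds required of an embedding at the pair [x], [y]: it is
    injective, and for far pairs the separation is at least the power
    (m-4)/(m+8) of the distance, expressed through a power of two. *)
Definition separates (f : 'I_(n1 + n2) -> V -> int) x y :=
  (x != y -> exists i, f i x != f i y) /\
  ((2 * s0 < d x y)%N -> exists e i, (d x y <= 2 ^ ((m + 8) * e))%N /\
     (2 ^ ((m - 4) * e))%:Z <= `|f i x - f i y|).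

(** The bits of the colours and the multi-scale coordinates together separate all
    pairs of points of a finite set. *)
Lemma embed_on_seq (S : seq V) : exists f : 'I_(n1 + n2) -> V -> int,
  (forall i x y, `|f i x - f i y| <= (d x y)%:Z) /\
  (forall x y, x \in S -> y \in S -> separates f x y).
Proof.
have d00 x : d x x = 0%N by apply/eqP; rewrite d0.
have s1 : (1 <= 2 * s0)%N by rewrite muln_gt0 expn_gt0.
have cn1 : ((2 * s0).+1 ^ P <= 2 ^ n1)%N.
  rewrite /n1 (mulnC P) expnM leq_expl // /s0 -addn2 expnD; have := expn_gt0 2 (m * e0); lia.
have [c hc] := proper_colouring S s1 cn1.
have [F [Flip Fsep]] := embed_finite R d00 dC dtri pack m14 me0 e_large S.
pose f (i : 'I_(n1 + n2)) x : int :=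
  match fintype.split i with inl a => (c x a : nat)%:Z | inr b => F b x end.
exists f; split.
  move=> i x y; rewrite /f; case: (fintype.split i) => [a|b]; last exact: Flip.
  have [<-|xy] := eqVneq x y; first by rewrite subrr d00.
  have : (0 < d x y)%N by rewrite lt0n d0.
  by case: (c x a); case: (c y a) => /=; lia.
move=> x y xS yS; have far : (2 * s0 < d x y)%N -> exists e i,
    (d x y <= 2 ^ ((m + 8) * e))%N /\ (2 ^ ((m - 4) * e))%:Z <= `|f i x - f i y|.
  move=> /(Fsep x y xS yS)[k [b hb]]; exists (scale_exp m e0 k), (rshift n1 b).
  by rewrite /f; case: fintype.splitP => j /= jb; [have := ltn_ord j; lia|];
     have -> : j = b by apply/val_inj/(@addnI n1).
split=> // xy; have [/far[e [i [_ h]]]|dxy] := ltnP (2 * s0) (d x y).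
  exists i; apply: contraTneq h => ->; rewrite subrr normr0 -ltNge ltz_nat.
  by rewrite expn_gt0.
have := hc x y xS yS xy dxy; apply: contraNP => nosep; apply/eqP/ffunP => a.
have [//|ca] := eqVneq (c x a) (c y a); case: nosep; exists (lshift n2 a).
rewrite /f; case: fintype.splitP => j /= jb; last by have := ltn_ord a; lia.
have -> : j = a by exact/val_inj.
by move: ca; case: (c x a); case: (c y a).
Qed.

Variable x0 : V.
Hypothesis ball_fin : forall N, exists S : seq V, forall y, (d x0 y <= N)%N -> y \in S.

Lemma embed_metric : exists f : 'I_(n1 + n2) -> V -> int,
  (forall i x y, `|f i x - f i y| <= (d x y)%:Z) /\ (forall x y, separates f x y).
Proof.
have [S hS] := choice ball_fin.
have [F hF] := choice (fun N => embed_on_seq (S N)).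
have [f hf] := lipschitz_limit x0 (fun N => (hF N).1).
exists f; split.
  by move=> i x y; have [N _ ->] := hf x y 0%N; exact: (hF N).1.
move=> x y; have [N Nxy fN] := hf x y (maxn (d x0 x) (d x0 y)).
have [||h1 h2] := (hF N).2 x y; try by apply: hS; lia.
split=> [/h1[i Fi]|/h2[e [i [de Fi]]]]; last by exists e, i; rewrite fN.
by exists i; rewrite -subr_eq0 fN subr_eq0.
Qed.
End MetricEmbedding.

(** * The metric and the growth of a connected graph *)

Section GraphMetric.
Variable G : sgraph.
Hypothesis connG : connected_graph G.
Implicit Types u v w : G.

Lemma connectedP u v : reachable u v.
Proof. exact: connG.2. Qed.

Lemma dist_walk u v : walk u v (dist u v).
Proof.
rewrite /dist; case: pselect => [h|/(_ (connectedP u v))//].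
by case: ex_minnP => k /asboolP.
Qed.

Lemma dist_le u v n : walk u v n -> (dist u v <= n)%N.
Proof.
move=> uvn; rewrite /dist; case: pselect => // h.
by case: ex_minnP => k _; apply; apply/asboolP.
Qed.

Lemma dist_eq0 u v : (dist u v == 0%N) = (u == v).
Proof.
apply/idP/idP => [/eqP d0|/eqP->].
  by have [p [_ lp sp]] := dist_walk u v; move: sp lp; rewrite d0 => /size0nil -> /= ->.
by rewrite -leqn0; apply: dist_le; exists [::].
Qed.

Lemma dist_triangle u v w : (dist u w <= dist u v + dist v w)%N.
Proof.
have [p [up lp sp]] := dist_walk u v; have [q [vq lq sq]] := dist_walk v w.
apply: dist_le; exists (p ++ q).
by rewrite cat_path last_cat size_cat up lp vq lq sp sq.
Qed.

Lemma dist_sym_le u v : (dist v u <= dist u v)%N.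
Proof.
have [p [up lp sp]] := dist_walk u v.
apply: dist_le; exists (rev (belast u p)); rewrite -lp; split.
- by rewrite rev_path (eq_path (e' := @adj G)) // => x y; exact: adj_sym.
- by case: (p) => //= a s; rewrite rev_cons last_rcons.
- by rewrite size_rev size_belast lp.
Qed.

Lemma dist_sym u v : dist u v = dist v u.
Proof. by apply/eqP; rewrite eqn_leq !dist_sym_le. Qed.

Lemma gball_dist u r v : gball u r v <-> (dist u v <= r)%N.
Proof. by split=> [[]//|]; split=> //; exact: connectedP. Qed.

Variables (R : realType) (rho : R) (P : nat).
Hypothesis rhoP : rho <= P%:R.
Hypothesis erG : exact_growth_rate R G = rho%:E.

(** Since (r+1)^rho <= (r+1)^P, the exact growth rate controls the cardinality of
    balls; in particular they are finite. *)
Lemma growth_le r : (1 <= r)%N -> (growth R G r <= ((r.+1 ^ P)%:R)%:E)%E.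
Proof.
move=> r1; have lnr : 0 < ln (r.+1%:R : R) by rewrite ln_gt0 // ltr1n ltnS.
have : (growth_exponent R G r <= rho%:E)%E.
  by rewrite -erG; apply: ereal_sup_ubound; exists r.
rewrite /growth_exponent; case: (growth R G r) => [g| |] /=.
- have [g0 _|g0] := leP g 0.
    by rewrite lee_fin (le_trans g0).
  rewrite -EFinM !lee_fin ler_pdivrMr // => hg.
  rewrite -ler_ln ?posrE // ?ltr0n ?expn_gt0 //.
  rewrite natrX lnXn // -[leRHS]mulr_natl (le_trans hg) //.
  by rewrite ler_wpM2r // ltW.
- by rewrite gt0_mulye ?lte_fin ?invr_gt0 // leye_eq.
- by rewrite leNye.
Qed.

Lemma gball_fset u r : (1 <= r)%N ->
  exists2 B : seq G, (size B <= r.+1 ^ P)%N & forall v, (dist u v <= r)%N -> v \in B.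
Proof.
move=> r1; have : (counting (gball u r) <= ((r.+1 ^ P)%:R : R)%:E)%E.
  by apply: le_trans (growth_le r1); apply: ereal_sup_ubound; exists u.
rewrite /counting; case: asboolP => [fB|_]; last by rewrite leye_eq.
rewrite lee_fin ler_nat => sB; exists (finmap.enum_fset (fset_set (gball u r))) => // v uv.
by rewrite in_fset_set // inE; apply/gball_dist.
Qed.

Lemma gball_pack u r (t : seq G) : (1 <= r)%N -> uniq t ->
  (forall v, v \in t -> (dist u v <= r)%N) -> (size t <= r.+1 ^ P)%N.
Proof.
move=> r1 ut tu; have [B sB hB] := gball_fset u r1.
by apply: leq_trans sB; apply: uniq_leq_size => // v /tu /hB.
Qed.

Lemma gball_finite u N : exists B : seq G, forall v, (dist u v <= N)%N -> v \in B.
Proof.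
have [B _ hB] := gball_fset u (isT : 1 <= N.+1)%N.
by exists B => v vN; apply: hB; exact: leqW.
Qed.
End GraphMetric.

(** * The constants *)

Section Constants.
Variable R : realType.

Lemma ln2_ge_half : 2^-1 <= ln (2 : R).
Proof.
have := @le_ln1Dx R (- 2^-1); rewrite (_ : 1 + - 2^-1 = 2^-1); last by lra.
by rewrite lnV ?posrE // => /(_ _); lra.
Qed.

(** The degree P of the growth: the least integer larger than rho. *)
Definition growth_degree (rho : R) := (Num.truncn rho).+1.
(** The initial exponent e_0, of order m + log P: large enough for
    [base_exp_large], and such that 2^(e_0) is polynomial in P for fixed m. *)
Definition base_exp (m P : nat) := (3 * (trunc_log 2 P + m + 5))%N.

Lemma base_exp_large m P e : (0 < P)%N -> (base_exp m P <= e)%N ->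
  (P * (m * e + 1) + e + 1 <= 2 ^ e)%N.
Proof.
rewrite /base_exp => P0 ee; have := trunc_log_ltn P (isT : 1 < 2)%N.
move: (trunc_log 2 P) ee => k ee Pk.
pose u := (e %/ 3)%N.
have eu : (e < 3 * u + 3)%N by have := ltn_ceil e (isT : 0 < 3)%N; rewrite /u; lia.
have ue : (3 * u <= e)%N by rewrite mulnC leq_trunc_div.
have ku : (k + m + 5 <= u)%N by rewrite leq_divRL //; lia.
have x0 : (P < 2 ^ u)%N by apply: leq_trans Pk _; rewrite leq_exp2l //; lia.
have x1 : (3 * u + 4 <= 2 ^ u)%N.
  have u5 : (5 <= u)%N by lia.
  elim: (u) u5 => // j IH; rewrite leq_eqVlt => /predU1P[<-//|/IH]; rewrite expnS; lia.
have x2 : (m + 2 <= 2 ^ u)%N by lia.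
apply: leq_trans (_ : 2 ^ u * (2 ^ u * 2 ^ u) <= _)%N; last first.
  by rewrite -!expnD leq_exp2l //; lia.
move: (2 ^ u)%N x0 x1 x2 => U x0 x1 x2.
have x3 : (m * e + 2 <= U * U)%N.
  have : (m * e <= U * e)%N by rewrite leq_mul2r; apply/orP; right; lia.
  have : (U * e <= U * (U - 2))%N by rewrite leq_mul2l; apply/orP; right; lia.
  nia.
have : (P * (m * e + 1) <= U * (U * U - 1))%N by apply: leq_mul; lia.
nia.
Qed.

(** The dimension is at most [dim_const m] times P (1 + log P). *)
Definition dim_const (m : nat) := (3 * m * (m + 5) + 8 * m + 14)%N.

Lemma dimension_le m P : (0 < P)%N ->
  (P * (m * base_exp m P + 2) + scale_dim P m <= dim_const m * (P * (trunc_log 2 P).+1))%N.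
Proof.
rewrite /base_exp /scale_dim /dim_const; move: (trunc_log 2 P) => k P0; nia.
Qed.

(** P (1 + log P) is of order max(rho log rho, 1); the values rho <= 4 are absorbed
    by the 1 in the maximum. *)
Lemma growth_degree_log_le (rho : R) : 0 <= rho ->
  (growth_degree rho * (trunc_log 2 (growth_degree rho)).+1)%:R <= 15 * Num.max (rho * ln rho) 1.
Proof.
move=> rho0; set P := growth_degree rho; set k := trunc_log 2 P.
have Prho : P%:R <= rho + 1 by rewrite -natr1 lerD2r truncn_le.
have kP : (2 ^ k <= P)%N by rewrite trunc_logP.
rewrite natrM -natr1.
have k0 : 0 <= k%:R :> R by [].
have P0 : 0 <= P%:R :> R by [].
have [rho4|rho4] := leP rho 4.
  have P5 : (P <= 5)%N by rewrite -(ler_nat R); lra.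
  have k2 : (k <= 2)%N.
    rewrite leqNgt; apply/negP => k3.
    have : (2 ^ 3 <= 2 ^ k)%N by rewrite leq_exp2l.
    lia.
  have P5R : P%:R <= 5 :> R by rewrite ler_nat.
  have k2R : k%:R <= 2 :> R by rewrite ler_nat.
  have : 1 <= Num.max (rho * ln rho) 1 by rewrite le_max lexx orbT.
  nra.
have ln4 : 1 <= ln rho.
  have : ln (2 ^+ 2) <= ln rho by rewrite ler_ln ?posrE; lra.
  by rewrite lnXn // -[leLHS]mulr_natl; have := ln2_ge_half; lra.
have kln : k%:R * 2^-1 <= 2 * ln rho.
  apply: le_trans (_ : ln ((2 ^ k)%:R : R) <= _).
    by rewrite natrX lnXn // -[leRHS]mulr_natl ler_wpM2l // ln2_ge_half.
  rewrite mulr_natl -lnXn; last by lra.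
  rewrite ler_ln ?posrE ?ltr0n ?expn_gt0 //; last by nra.
  apply: le_trans (_ : P%:R <= _); first by rewrite ler_nat.
  by apply: le_trans Prho _; nra.
have : rho * ln rho <= Num.max (rho * ln rho) 1 by rewrite le_max lexx.
have : P%:R * (k%:R + 1) <= (2 * rho) * (5 * ln rho) by apply: ler_pM; lra.
have : 0 <= rho * ln rho by rewrite mulr_ge0 //; lra.
lra.
Qed.

(** The exponent 1 - eps is at most (m-4)/(m+8) because 12 <= eps (m+8). *)
Lemma snowflake_bound (eps : R) (m e d : nat) : (4 <= m)%N -> 12 <= eps * (m + 8)%:R ->
  (0 < d)%N -> (d <= 2 ^ ((m + 8) * e))%N ->
  d%:R `^ (1 - eps) <= (2 ^ ((m - 4) * e))%:R.
Proof.
move=> m4 epsm d_gt0 dle.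
have m8 : 0 < (m + 8)%:R :> R by rewrite ltr0n; lia.
pose a : R := (m - 4)%:R / (m + 8)%:R.
have a0 : 0 <= a by rewrite divr_ge0 // ltW.
have ea : 1 - eps <= a.
  rewrite ler_pdivlMr // natrB // mulrBl mul1r natrD; move: epsm; rewrite natrD; lra.
apply: le_trans (_ : d%:R `^ a <= _); first by rewrite ler_powR // ler1n.
apply: le_trans (_ : ((2 ^ ((m + 8) * e))%:R : R) `^ a <= _).
  by apply: ge0_ler_powR => //; rewrite ?nnegrE // ler_nat.
rewrite mulnC expnM natrX -powR_mulrn // -powRrM /a mulrC divfK ?gt_eqF //.
by rewrite powR_mulrn // -natrX -expnM mulnC.
Qed.
End Constants.

(** * The theorem *)

Section SupNorm.
Variable n : nat.
Implicit Types M : 'rV[int]_n.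

Lemma mx_norm_le M (b : int) : 0 <= b -> (forall i, `|M ord0 i| <= b) -> mx_norm M <= b.
Proof.
by move=> b0 Mb; rewrite mx_normrE; apply: bigmax_le => // -[i j] _; rewrite (ord1 i).
Qed.

Lemma mx_norm_ge M i : `|M ord0 i| <= mx_norm M.
Proof.
by rewrite mx_normrE; exact: (le_bigmax _ (fun ij => `|M ij.1 ij.2|) (ord0, i)).
Qed.
End SupNorm.

Theorem corollary1p11 (R : realType) (eps : R) (eps_gt0 : 0 < eps) :
  exists C : R, 0 < C /\
  forall rho : R, 0 <= rho ->
  exists c r0 : R, [/\ 0 < c, 1 <= r0 &
  forall G : sgraph,
    connected_graph G -> exact_growth_rate R G = rho%:E ->
  exists (n : nat) (f : G -> 'rV[int]_n),
    [/\ n%:R <= C * Num.max (rho * ln rho) 1,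
        injective f,
        (forall u v : G, mx_norm (f u - f v) <= (dist u v)%:Z) &
        (forall u v : G, r0 <= (dist u v)%:R ->
           c * (dist u v)%:R `^ (1 - eps) <= (mx_norm (f u - f v))%:~R)]].
Proof.
pose m := (Num.truncn (12 / eps) + 14)%N.
have m14 : (14 <= m)%N by rewrite leq_addl.
have epsm : 12 <= eps * (m + 8)%:R.
  rewrite mulrC -ler_pdivrMr //; apply/ltW/(lt_le_trans (truncnS_gt _)).
  rewrite ler_nat /m; move: (Num.truncn _) => a; lia.
exists ((dim_const m)%:R * 15); split; first by rewrite mulr_gt0 // ltr0n /dim_const; lia.
move=> rho rho0; pose P := growth_degree rho; pose e0 := base_exp m P.
(* The threshold 2 s_0 + 1 separates near pairs from far pairs. *)
exists 1, (2 * 2 ^ (m * e0)).+1%:R; split=> //; first by rewrite ler1n.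
move=> G connG erG.
have rhoP : rho <= P%:R by apply/ltW/truncnS_gt.
have me0 : (3 * m <= e0)%N by rewrite /e0 /base_exp; lia.
have [x0] := connG.1.
have [f [flip fsep]] := embed_metric R (dist_eq0 connG) (dist_sym connG)
  (dist_triangle connG) (gball_pack connG rhoP erG) m14 me0
  (fun e => base_exp_large (e := e) (ltn0Sn _)) (gball_finite connG rhoP erG x0).
exists _, (fun x => \row_i f i x); split.
- apply: le_trans (_ : (dim_const m * (P * (trunc_log 2 P).+1))%:R <= _).
    by rewrite ler_nat dimension_le.
  by rewrite natrM -mulrA ler_wpM2l // growth_degree_log_le.
- move=> x y exy; apply: contrapT => /eqP xy.
  have [/(_ xy)[i /eqP ne] _] := fsep x y.
  by apply: ne; move/rowP/(_ i): exy; rewrite !mxE.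
- by move=> x y; apply: mx_norm_le => // i; rewrite !mxE.
move=> x y; rewrite ler_nat => dxy; rewrite mul1r.
have [_ /(_ dxy)[e [i [de fi]]]] := fsep x y.
apply: le_trans (snowflake_bound _ epsm _ de) _; [lia|lia|].
rewrite pmulrn ler_int; apply: le_trans fi _.
by have := mx_norm_ge ((\row_i f i x) - (\row_i f i y)) i; rewrite !mxE.
Qed.
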